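(* Let $n\ge 4$, let $k_1,\dots,k_n$ be generic massless momenta satisfying momentum conservation, and let $h_1,\dots,h_{n-3}\in R=\mathbb{C}[z_3,\dots,z_{n-1}]$ be the polynomial scattering equations (with $z_2=1$). Then $\{h_1,\dots,h_{n-3}\}$ is an $H$-basis of the ideal $I=\langle h_1,\dots,h_{n-3}\rangle\subseteq R$.
   Context: Kinematics: $k_1,\dots,k_n\in\mathbb{C}^D$ are vectors with a symmetric bilinear product $k\cdot k'$, $k^2:=k\cdot k$, satisfying $k_a^2=0$ for all $a$ and $\sum_{a=1}^n k_a=0$. Generic means $\left(\sum_{a\in T}k_a\right)^2\neq 0$ for every $T\subset\{1,\dots,n\}$ with $2\le |T|\le n-2$. Polynomial scattering equations: for $1\le m\le n-3$, $$h_m=\sum_{S\subset\{2,\dots,n-1\},\ |S|=m}\sigma_S\prod_{a\in S}z_a,\qquad \sigma_S=\Big(k_1+\sum_{a\in S}k_a\Big)^2,$$ with the gauge fixing $z_2=1$ imposed, so that $h_m$ is a polynomial in the $n-3$ variables $z_3,\dots,z_{n-1}$. $H$-basis: for a polynomial ring $R$ over a field and an ideal $I\subseteq R$, a finite set $\{f_1,\dots,f_k\}\subset I$ is an $H$-basis of $I$ if for every $f\in I$ there exist $q_1,\dots,q_k\in R$ such that $f=\sum_{i=1}^k q_if_i$ and $\max_i\deg(q_if_i)=\deg f$ (total degree). *)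

(* Defs.v *)
From HB Require Import structures.
From mathcomp Require Import all_boot all_order all_algebra.
From mathcomp Require Import reals complex.
From mathcomp Require Import mpoly.

Set Implicit Arguments.
Unset Strict Implicit.
Unset Printing Implicit Defensive.

Import GRing.Theory.

Local Open Scope ring_scope.

(* The particles 1, ..., n are the elements of 'I_n, which are numbered from
   0: the particle a : 'I_n has label a.+1. *)
Definition label (n : nat) (a : 'I_n) : nat := a.+1.

Section Kinematics.

Variables (F : fieldType) (D n : nat).
Variables (dot : {symmetric 'rV[F]_D}) (k : 'I_n -> 'rV[F]_D).

Definition sq (v : 'rV[F]_D) : F := dot v v.

Definition massless : Prop := forall a : 'I_n, sq (k a) = 0.

Definition momentum_conservation : Prop := \sum_(a : 'I_n) k a = 0.

Definition generic_momenta : Prop :=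
  forall T : {set 'I_n}, (2 <= #|T| <= n - 2)%N ->
    sq (\sum_(a in T) k a) != 0.

(* The first sum has exactly one term, the momentum of the particle 1. *)
Definition sigma (S : {set 'I_n}) : F :=
  sq (\sum_(a : 'I_n | label a == 1%N) k a + \sum_(a in S) k a).

(* z_a in the polynomial ring F[z_3, ..., z_(n-1)], whose variable z_a is
   'X_(a - 3), with z_2 = 1.  The last case only arises for the particles 1
   and n, which do not occur in the scattering equations. *)
Definition zvar (a : 'I_n) : {mpoly F[n - 3]} :=
  if label a == 2 then 1
  else if (2 < label a)%N then
    if insub (label a - 3)%N is Some j then 'X_j else 0
  else 0.

Definition scattering_poly (m : nat) : {mpoly F[n - 3]} :=
  \sum_(S : {set 'I_n} |
        (S \subset [set a | (2 <= label a <= n - 1)%N]) && (#|S| == m))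
     sigma S *: \prod_(a in S) zvar a.

(* h_1, ..., h_(n-3), indexed from 0. *)
Definition scattering_polys (i : 'I_(n - 3)) : {mpoly F[n - 3]} :=
  scattering_poly i.+1.

End Kinematics.

Section HBasis.

Variables (F : fieldType) (N r : nat).

Definition generated_ideal (f : 'I_r -> {mpoly F[N]}) (g : {mpoly F[N]}) :
    Prop :=
  exists q : 'I_r -> {mpoly F[N]}, g = \sum_(i < r) q i * f i.

(* [msize p] is 1 + deg p for p != 0, and msize 0 = 0 plays the role of
   deg 0 = -oo; equality of maximal degrees is thus equality of maximal
   sizes. *)
Definition H_basis (I : {mpoly F[N]} -> Prop) (f : 'I_r -> {mpoly F[N]}) :
    Prop :=
  (forall i, I (f i)) /\
  (forall g, I g ->
     exists q : 'I_r -> {mpoly F[N]},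
       g = \sum_(i < r) q i * f i /\
       (\max_(i < r) msize (q i * f i))%N = msize g).

End HBasis.

(* Main.v *)
(* The leading form f_m of h_m is the combination of all squarefree monomials of
   degree m in z_3, ..., z_(n-1) with the coefficients sigma_S, which are nonzero
   for generic momenta.  As in every complete intersection, it suffices that all
   syzygies of f_1, ..., f_(n-3) are Koszul syzygies: cancellations of leading
   terms in sum q_m h_m can then be removed with the Koszul syzygies of the h_m.
   The Koszul property is shown by induction on the number of variables: the last
   form is a nonzero multiple of the product of all variables, the property of
   the other forms modulo p is stable under products of p, and modulo one
   variable z_a the other forms become the forms for the remaining variables. *)
From HB Require Import structures.
Require Import Defs.
From mathcomp Require Import all_boot all_order all_algebra.
From mathcomp Require Import reals complex.
From mathcomp Require Import mpoly ring zify.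

Set Implicit Arguments.
Unset Strict Implicit.
Unset Printing Implicit Defensive.

Import GRing.Theory.

Local Open Scope ring_scope.

(** * Koszul syzygies modulo an element of a domain *)

Section KoszulSyzygies.

Variable R : idomainType.
Implicit Types (p : R) (r : nat) (x : nat -> R).

(* The antisymmetric matrix of coefficients of a Koszul syzygy is written as
   u - u^T, which spares a side condition. *)
Definition koszul_mod p r x : Prop :=
  forall (q : nat -> R) g, \sum_(i < r) q i * x i = p * g ->
    exists (u : nat -> nat -> R) (t : nat -> R), forall i, (i < r)%N ->
      q i = \sum_(j < r) (u i j - u j i) * x j + p * t i.

Lemma antisymmetric_sum r (u : nat -> nat -> R) x :
  \sum_(i < r) (\sum_(j < r) (u i j - u j i) * x j) * x i = 0.
Proof.
transitivity (\sum_(i < r) \sum_(j < r) u i j * x j * x i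
              - \sum_(i < r) \sum_(j < r) u j i * x j * x i).
  rewrite -sumrB; apply: eq_bigr => i _.
  rewrite mulr_suml -sumrB; apply: eq_bigr => j _.
  by rewrite mulrBl mulrBl.
apply/eqP; rewrite subr_eq0 [X in _ == X]exchange_big /=; apply/eqP.
by apply: eq_bigr => i _; apply: eq_bigr => j _; rewrite mulrAC.
Qed.

Lemma koszul_mod_unit p r x : p \is a GRing.unit -> koszul_mod p r x.
Proof.
move=> pU q g _; exists (fun _ _ => 0), (fun i => p^-1 * q i) => i _.
rewrite big1 => [|j _]; last by rewrite subrr mul0r.
by rewrite add0r mulVKr.
Qed.

(** The Koszul part of a syzygy modulo [p1] drops out of the sum, so cancelling [p1] makes the
    remainder [t1] a syzygy modulo [p2]. *)
Lemma koszul_mod_mul p1 p2 r x :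
  p1 != 0 -> koszul_mod p1 r x -> koszul_mod p2 r x -> koszul_mod (p1 * p2) r x.
Proof.
move=> p1_neq0 K1 K2 q g; rewrite -mulrA => Eq.
have [u1 [t1 Eq1]] := K1 _ _ Eq.
have /K2[u2 [t2 Et1]] : \sum_(i < r) t1 i * x i = p2 * g.
  apply: (mulfI p1_neq0); rewrite -Eq.
  under [RHS]eq_bigr => i _ do rewrite Eq1 // mulrDl -mulrA.
  by rewrite big_split /= antisymmetric_sum add0r mulr_sumr.
exists (fun i j => u1 i j + p1 * u2 i j), t2 => i lt_ir.
rewrite Eq1 // Et1 // mulrDr mulrA addrA; congr (_ + _).
rewrite mulr_sumr -big_split /=; apply: eq_bigr => j _; ring.
Qed.

(** The first [r] cofactors form a syzygy modulo [x r]; cancelling [x r] then expresses [q r]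
    through the remainders [t]. *)
Lemma koszul_mod_extend r x :
  x r != 0 -> koszul_mod (x r) r x -> koszul_mod 0 r.+1 x.
Proof.
move=> xr_neq0 K q g; rewrite mul0r big_ord_recr /= => Eq.
have /K[u [t Et]] : \sum_(i < r) q i * x i = x r * - q r.
  by rewrite mulrN [x r * _]mulrC; apply/eqP; rewrite -addr_eq0 Eq.
have Eqr : q r = - \sum_(j < r) t j * x j.
  apply: (mulIf xr_neq0); rewrite mulNr; apply/eqP; rewrite -addr_eq0 addrC.
  rewrite -[X in _ == X]Eq; apply/eqP; congr (_ + _).
  under [RHS]eq_bigr => i _ do rewrite Et // mulrDl -mulrA.
  rewrite big_split /= antisymmetric_sum add0r mulr_suml.
  by apply: eq_bigr => i _; rewrite mulrC.
(* Column [r] is [t] and row [r] is 0, so [u - u^T] is bordered by [t] and [-t]. *)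
exists (fun i j => if (i < r)%N then if (j < r)%N then u i j else t i else 0).
exists (fun=> 0) => i; rewrite ltnS leq_eqVlt mul0r addr0 big_ord_recr /= ltnn.
case: eqP => [-> _ | _ /= lt_ir].
  rewrite ltnn subrr mul0r addr0 Eqr -sumrN.
  by apply: eq_bigr => j _; rewrite ltn_ord sub0r mulNr.
rewrite lt_ir subr0 [t i * _]mulrC Et //; congr (_ + _).
by apply: eq_bigr => j _; rewrite ltn_ord.
Qed.

(** [rho] stands for reduction modulo [p]: a Koszul matrix found for the images also serves for [q],
    up to multiples of [p]. *)
Lemma koszul_mod_specialize (rho : {rmorphism R -> R}) p r x y :
  rho p = 0 -> (forall a : R, exists t, a == rho a + p * t) ->
  (forall i, (i < r)%N -> rho (x i) = y i) ->
  koszul_mod 0 r y -> koszul_mod p r x.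
Proof.
move=> rho_p rhoE Ey K q g Eq.
(* The boolean equality in [rhoE] lets [xchoose] pick the quotients. *)
pose delta a := xchoose (rhoE a).
have deltaE a : a = rho a + p * delta a by apply/eqP/(xchooseP (rhoE a)).
have /(K (rho \o q))[u [t Et]] : \sum_(i < r) rho (q i) * y i = 0 * 0.
  transitivity (rho (\sum_(i < r) q i * x i)).
    by rewrite rmorph_sum; apply: eq_bigr => i _; rewrite rmorphM Ey.
  by rewrite Eq rmorphM rho_p !mul0r.
exists u.
exists (fun i => delta (q i) - \sum_(j < r) (u i j - u j i) * delta (x j)).
rewrite /= in Et; move=> i lt_ir.
rewrite [LHS]deltaE Et // mul0r addr0 mulrBr [RHS]addrCA [LHS]addrC.
congr (_ + _).
apply/eqP; rewrite eq_sym subr_eq; apply/eqP.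
rewrite mulr_sumr -big_split /=; apply: eq_bigr => j _.
by rewrite {1}[x j]deltaE Ey // mulrDr; congr (_ + _); ring.
Qed.

End KoszulSyzygies.

(** * Combinations of squarefree monomials of fixed degree *)

Section SquarefreeForms.

Variables (R : idomainType) (I : finType) (c : {set I} -> R) (z : I -> R).

Definition squarefree_form (A : {set I}) (m : nat) : R :=
  \sum_(S : {set I} | (S \subset A) && (#|S| == m)) c S * \prod_(a in S) z a.

Lemma squarefree_form_card (A : {set I}) :
  squarefree_form A #|A| = c A * \prod_(a in A) z a.
Proof.
rewrite /squarefree_form (big_pred1 A) // => S /=.
by rewrite eqEcard; case: (boolP (S \subset A)) => //= /subset_leq_card;
   rewrite eqn_leq => ->.
Qed.

(** [rho a] plays the role of setting [z a] to 0. The empty set is left out of [c_unit]: its [sigma]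
    is the square of [k_1], which is 0 for massless momenta. *)
Variables (A0 : {set I}) (rho : I -> {rmorphism R -> R}).
Hypotheses
  (c_unit : forall S : {set I}, S \subset A0 -> S != set0 ->
     c S \is a GRing.unit)
  (z_neq0 : forall a, a \in A0 -> z a != 0)
  (rho_c : forall a S, rho a (c S) = c S)
  (rho_z : forall a b, a \in A0 -> b \in A0 ->
     rho a (z b) = if a == b then 0 else z b)
  (rhoE : forall a p, a \in A0 -> exists t, p == rho a p + z a * t).

(** Terms with [a] in [S] vanish; the other [S] are the subsets of [A :\ a], and their terms are
    fixed. *)
Lemma squarefree_form_specialize (A : {set I}) a m :
  A \subset A0 -> a \in A ->
  rho a (squarefree_form A m) = squarefree_form (A :\ a) m.
Proof.
move=> sAA0 Aa; have A0a := subsetP sAA0 _ Aa.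
rewrite rmorph_sum /= (bigID (fun S : {set I} => a \in S)) /=.
rewrite big1 ?add0r => [|S /andP[/andP[sSA _] Sa]]; last first.
  by rewrite rmorphM rmorph_prod (bigD1 a) //= rho_z // eqxx mul0r mulr0.
apply: eq_big => [S|S /andP[/andP[sSA _] aS]].
  by rewrite subsetD1 andbAC.
rewrite rmorphM rho_c rmorph_prod; congr (_ * _); apply: eq_bigr => b Sb.
rewrite rho_z //; last exact/(subsetP sAA0)/(subsetP sSA).
by case: eqP => // ab; rewrite ab Sb in aS.
Qed.

(* The last form is a unit times the product of the variables, so the syzygies
   of the other forms may be tested modulo one variable at a time; setting a
   variable to 0 yields the same situation with one variable less. *)
Lemma squarefree_forms_koszul (A : {set I}) :
  A \subset A0 -> koszul_mod 0 #|A| (fun i => squarefree_form A i.+1).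
Proof.
have [r] := ubnP #|A|; elim: r A => // r IHr A ltAr sAA0.
case EA: #|A| => [|N]; first by move=> q g _; exists (fun _ _ => 0), (fun=> 0).
have A_neq0 : A != set0 by rewrite -card_gt0 EA.
have cU : c A \is a GRing.unit by apply: c_unit.
have prod_neq0 : \prod_(a in A) z a != 0.
  by apply/prodf_neq0 => a /(subsetP sAA0)/z_neq0.
apply: koszul_mod_extend; rewrite -EA squarefree_form_card.
  by rewrite mulf_neq0 // (memPn _ _ cU) // unitr0.
apply: koszul_mod_mul; [by rewrite (memPn _ _ cU) // unitr0 | |].
  exact: koszul_mod_unit.
suff [] : \prod_(a in A) z a != 0 /\
    koszul_mod (\prod_(a in A) z a) N (fun i => squarefree_form A i.+1) by [].
apply: (big_rec (fun p => p != 0 /\ koszul_mod p N _)) => [|a p Aa [p0 Kp]].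
  by split; [exact: oner_neq0 | apply/koszul_mod_unit/unitr1].
have A0a := subsetP sAA0 _ Aa; have za0 := z_neq0 A0a.
split; first exact: mulf_neq0.
apply: koszul_mod_mul => //.
have EN : #|A :\ a| = N by move: (cardsD1 a A); rewrite Aa EA => -[].
apply: (@koszul_mod_specialize _ (rho a) _ _ _
          (fun i => squarefree_form (A :\ a) i.+1)).
- by rewrite rho_z ?eqxx.
- by move=> p'; apply: rhoE.
- by move=> i _; apply: squarefree_form_specialize.
rewrite -EN; apply: IHr; last exact: subset_trans (subD1set _ _) sAA0.
by rewrite EN -ltnS -EA.
Qed.

End SquarefreeForms.

(** * From Koszul leading forms to an H-basis *)

Section LeadingForms.

Variables (F : fieldType) (N : nat).
Implicit Types (p q f h : {mpoly F[N]}) (d e b : nat) (m : 'X_{1..N}).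

(* Degrees are shifted by e, so that d and e can be compared without
   subtraction: [low d e p] says deg p + e < d, and [hpart d e p] is the
   homogeneous part of p of degree d - e, or 0 if d < e. *)
Definition low d e p : Prop := forall m, (d <= mdeg m + e)%N -> p@_m = 0.

Definition hpart d e p : {mpoly F[N]} :=
  \sum_(m <- msupp p | (mdeg m + e == d)%N) p@_m *: 'X_[m].

Lemma mcoeff_hpart d e p m :
  (hpart d e p)@_m = if (mdeg m + e == d)%N then p@_m else 0.
Proof.
rewrite raddf_sum /= big_mkcond /=.
case: (boolP (m \in msupp p)) => [m_p | m_notin].
  rewrite (bigD1_seq m) ?msupp_uniq //= mcoeffZ mcoeffX eqxx mulr1.
  rewrite big1 ?addr0 // => m' /negPf m'm.
  by case: ifP; rewrite // mcoeffZ mcoeffX m'm mulr0.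
rewrite (memN_msupp_eq0 m_notin) if_same big_seq big1 // => m' m'_p.
rewrite mcoeffZ mcoeffX; have [Em | _] := eqVneq m' m.
  by rewrite -Em m'_p in m_notin.
by rewrite mulr0 if_same.
Qed.

Lemma hpart_is_zmod_morphism d e : zmod_morphism (hpart d e).
Proof.
move=> p q; apply/mpolyP => m; rewrite mcoeffB !mcoeff_hpart mcoeffB.
by case: ifP => // _; rewrite subr0.
Qed.

HB.instance Definition _ d e :=
  GRing.isZmodMorphism.Build {mpoly F[N]} {mpoly F[N]} (hpart d e)
    (hpart_is_zmod_morphism d e).

Lemma hpart_id d e p : hpart d e (hpart d e p) = hpart d e p.
Proof.
by apply/mpolyP => m; rewrite !mcoeff_hpart; case: eqP.
Qed.

Lemma hpart_low d e p : low d e p -> hpart d e p = 0.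
Proof.
move=> lowp; apply/mpolyP => m; rewrite mcoeff_hpart mcoeff0.
by case: eqP => // Ed; apply: lowp; rewrite Ed.
Qed.

Lemma low_hpart d e p : low d.+1 e (hpart d e p).
Proof.
move=> m le_dm; rewrite mcoeff_hpart; case: eqP => // Ed.
by rewrite Ed ltnn in le_dm.
Qed.

Lemma low_sub_hpart d e p : low d.+1 e p -> low d e (p - hpart d e p).
Proof.
move=> lowp m le_dm; rewrite mcoeffB mcoeff_hpart.
case: eqP => [_ | /eqP ne]; first by rewrite subrr.
by rewrite subr0 lowp // ltn_neqAle eq_sym ne.
Qed.

Lemma lowB d e p q : low d e p -> low d e q -> low d e (p - q).
Proof. by move=> lp lq m ledm; rewrite mcoeffB lp // lq // subr0. Qed.

Lemma low_sum d e (I : finType) (P : pred I) (G : I -> {mpoly F[N]}) :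
  (forall i, P i -> low d e (G i)) -> low d e (\sum_(i | P i) G i).
Proof.
by move=> lG m ledm; rewrite raddf_sum big1 // => i Pi; apply: lG.
Qed.

(** Both degree bounds are strict, so adding them gains one unit: hence the successor in the
    hypothesis. *)
Lemma low_mul d d' e b c p q : (d' + c <= (d + b).+1)%N ->
  low d' (e + b) p -> low c 0 q -> low d e (p * q).
Proof.
move=> le_d lp lq m ledm; rewrite mcoeffM big1 // => -[k1 k2] /= /eqP Em.
have [/lp -> | lt1] := leqP d' (mdeg k1 + (e + b)); first by rewrite mul0r.
rewrite (lq k2) ?mulr0 //; rewrite Em mdegD in ledm; lia.
Qed.

Lemma low_le d d' e e' p : (d + e' <= d' + e)%N -> low d e p -> low d' e' p.
Proof. by move=> le lp m le'; apply: lp; lia. Qed.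

Lemma lowP d p : low d 0 p <-> (msize p <= d)%N.
Proof.
split=> [lp | le_pd m le_dm]; last first.
  rewrite addn0 in le_dm.
  by apply/memN_msupp_eq0/msize_mdeg_ge/(leq_trans le_pd).
rewrite msizeE; apply/bigmax_leqP_seq => m m_p _; rewrite ltnNge.
apply/negP => le_dm; move: m_p; rewrite mcoeff_msupp lp ?eqxx //.
by rewrite addn0.
Qed.

Lemma hpart_mul d e b p f : f \is b.-homog ->
  hpart d e (p * f) = hpart d (e + b) p * f.
Proof.
move=> homf; apply/mpolyP => m; rewrite mcoeff_hpart !mcoeffM.
transitivity (\sum_(k : 'X_{1..N < (mdeg m).+1, (mdeg m).+1}
    | m == (k.1 + k.2)%MM)
    if (mdeg m + e == d)%N then p@_k.1 * f@_k.2 else 0).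
  by case: eqP => // _; rewrite big1.
apply: eq_bigr => -[k1 k2] /= /eqP Em; rewrite mcoeff_hpart.
have [Eb | nek2] := eqVneq (mdeg k2) b.
  have -> : (mdeg m + e = mdeg k1 + (e + b))%N.
    by rewrite {1}Em mdegD Eb -addnA [(b + e)%N]addnC.
  by case: eqP => // _; rewrite mul0r.
by rewrite (dhomog_nemf_coeff homf nek2) !mulr0 if_same.
Qed.

Variables (r : nat) (e : nat -> nat) (h f : nat -> {mpoly F[N]}).
Hypotheses
  (f_homog : forall i, (i < r)%N -> f i \is (e i).-homog)
  (h_sub_f : forall i, (i < r)%N -> low (e i) 0 (h i - f i))
  (f_koszul : koszul_mod 0 r f).

(* If the terms of degree d cancel in sum q_i h_i, their cofactors form a
   syzygy of the leading forms; subtracting the corresponding Koszul syzygy of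
   the h_i lowers the degree of the representation. *)
Lemma lower_representation d g (q : nat -> {mpoly F[N]}) :
  low d 0 g -> g = \sum_(i < r) q i * h i ->
  (forall i, (i < r)%N -> low d.+1 (e i) (q i)) ->
  exists q' : nat -> {mpoly F[N]}, g = \sum_(i < r) q' i * h i /\
    (forall i, (i < r)%N -> low d (e i) (q' i)).
Proof.
move=> lowg Eg lowq; pose a i := hpart d (e i) (q i).
have Ea : \sum_(i < r) a i * f i = 0 * 0.
  transitivity (hpart d 0 g); last by rewrite hpart_low // mul0r.
  rewrite Eg raddf_sum /=; apply: eq_bigr => i _.
  rewrite -[h i](subrK (f i)) mulrDr raddfD /=.
  rewrite (hpart_mul _ 0 _ (f_homog _)) //.
  rewrite [X in _ = X + _]hpart_low ?add0r //.
  by apply: (@low_mul _ d.+1 0 (e i) (e i)) (lowq i _) (h_sub_f _) => //; lia.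
have [u [t Et]] := f_koszul Ea.
(* Cutting [u i j] down to degree [d - e i - e j] keeps the identity for [a] and prevents the
   correction from bringing in higher terms. *)
pose w i j := hpart d (e i + e j) (u i j).
have Ew i : (i < r)%N -> a i = \sum_(j < r) (w i j - w j i) * f j.
  move=> lt_ir; rewrite {1}/a -hpart_id -/(a i) Et // mul0r addr0 raddf_sum /=.
  apply: eq_bigr => j _; rewrite (hpart_mul _ _ _ (f_homog _)) // raddfB /=.
  by rewrite /w [(e j + _)%N]addnC.
exists (fun i => q i - \sum_(j < r) (w i j - w j i) * h j); split.
  under eq_bigr => i _ do rewrite mulrBl.
  by rewrite sumrB antisymmetric_sum subr0.
(* The new cofactor is [q i - a i] minus the combination of the [h j - f j]; both lack the terms of
   top degree. *)
move=> i lt_ir; rewrite -[q i](subrK (a i)) -addrA; rewrite -[X in _ + X]opprB.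
apply: lowB; first exact/low_sub_hpart/lowq.
rewrite Ew // -sumrB; apply: low_sum => j _; rewrite -mulrBr.
apply: (@low_mul _ d.+1 _ (e j) (e j)) (h_sub_f _) => //.
by apply: lowB; [|rewrite addnC]; apply: low_hpart.
Qed.

(** The cofactors of any representation exceed the desired bounds by at most some [D]; induction on
    [D] removes the excess. *)
Lemma H_basis_of_koszul :
  H_basis (generated_ideal (fun i : 'I_r => h i)) (fun i : 'I_r => h i).
Proof.
split=> [i | g [q0 Eg]].
  exists (fun j => (j == i)%:R); rewrite (bigD1 i) //= eqxx mul1r big1 ?addr0 //.
  by move=> j /negPf ->; rewrite mul0r.
have [q [{}Eg lowq]] : exists q : nat -> {mpoly F[N]},
    g = \sum_(i < r) q i * h i /\
    forall i, (i < r)%N -> low (msize g) (e i) (q i).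
  pose q i := if insub i is Some j then q0 j else 0.
  have Eq : g = \sum_(i < r) q i * h i.
    by rewrite Eg; apply: eq_bigr => i _; rewrite /q valK.
  have [D lowq] : exists D, forall i, (i < r)%N ->
      low (msize g + D) (e i) (q i).
    exists (\max_(i < r) (msize (q i) + e i))%N => i lt_ir.
    apply: (@low_le (msize (q i)) _ 0); last exact/lowP.
    rewrite addn0 (leq_trans _ (leq_addl _ _)) //.
    exact: (leq_bigmax (Ordinal lt_ir)).
  elim: D q Eq lowq => [|D IHD] q Eq lowq.
    by exists q; split=> // i lt_ir; rewrite -[msize g]addn0; apply: lowq.
  have lowg : low (msize g + D) 0 g by apply/lowP; apply: leq_addr.
  rewrite addnS in lowq.
  by have [q' [Eq' lowq']] := lower_representation lowg Eq lowq; apply: IHD lowq'.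
exists (fun i => q i); split=> //; apply/eqP; rewrite eqn_leq; apply/andP; split.
  apply/bigmax_leqP => i _; apply/lowP.
  apply: (@low_mul _ (msize g) _ (e i) (e i).+1); first lia.
    exact: lowq.
  rewrite -[h i](subrK (f i)) -[X in _ + X]opprK; apply: lowB.
    by apply: low_le (h_sub_f _) => //; lia.
  move=> m lt_em; rewrite mcoeffN (dhomog_nemf_coeff (f_homog _)) ?oppr0 //.
  by apply/eqP => /= Em; lia.
(* This inequality holds for every representation: a sum has at most the largest size of its
   terms. *)
by rewrite {1}Eg; apply: msize_sum.
Qed.

End LeadingForms.

(** * Setting one variable to 0 *)

Section KillVariable.

Variables (F : fieldType) (N : nat).
Implicit Types (p : {mpoly F[N]}).

(** The index is a natural number, so that [label a - 3] is accepted for every particle [a]. *)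
Definition kill_var (k : nat) : {rmorphism {mpoly F[N]} -> {mpoly F[N]}} :=
  comp_mpoly [tuple if (i : nat) == k then 0 else 'X_i : {mpoly F[N]} | i < N].

Lemma kill_varX k (i : 'I_N) :
  kill_var k 'X_i = if (i : nat) == k then 0 else 'X_i.
Proof. by rewrite /= comp_mpolyXU -tnth_nth tnth_mktuple. Qed.

(** A monomial without ['X_i] is fixed; any other is killed and divisible by ['X_i]. *)
Lemma kill_varE (i : 'I_N) p : exists t, p == kill_var i p + 'X_i * t.
Proof.
elim/mpolyind: p => [|c m p _ _ [t /eqP Et]].
  by exists 0; rewrite rmorph0 mulr0 addr0.
suff [t' /eqP Et'] : exists t', 'X_[m] == kill_var i 'X_[m] + 'X_i * t'.
  exists (c *: t' + t); rewrite {1}Et {1}Et' /= comp_mpolyD comp_mpolyZ.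
  by apply/eqP; rewrite scalerDr mulrDr -scalerAr addrACA.
rewrite /= comp_mpolyX; have [mi0 | mi_neq0] := eqVneq (m i) 0%N.
  exists 0; rewrite mulr0 addr0 mpolyXE_id; apply/eqP/eq_bigr => j _.
  rewrite tnth_mktuple; case: eqP => // /val_inj ->.
  by rewrite mi0 !expr0.
exists 'X_[(m - U_(i))%MM]; rewrite (bigD1 i) //= tnth_mktuple eqxx expr0n.
rewrite (negPf mi_neq0) mul0r add0r -mpolyXD addmC submK //.
by apply/mnm_lepP => j; rewrite mnm1E; case: eqP => // <-; rewrite lt0n.
Qed.

End KillVariable.

(** * Leading forms of the scattering polynomials *)

Section ScatteringEquations.

Variables (F : fieldType) (D n : nat).
Variables (dot : {symmetric 'rV[F]_D}) (k : 'I_n -> 'rV[F]_D).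
Hypotheses (hn : (4 <= n)%N) (hgeneric : generic_momenta dot k).

Definition free_particles : {set 'I_n} := [set a | (2 < label a <= n - 1)%N].

Lemma card_free_particles : #|free_particles| = (n - 3)%N.
Proof.
have lt_n (i : 'I_(n - 3)) : (i + 2 < n)%N by have := ltn_ord i; lia.
have inj_f : injective (fun i => Ordinal (lt_n i)).
  by move=> i j [Eij]; apply: val_inj => /=; lia.
rewrite -[RHS](card_ord (n - 3)) -(card_imset _ inj_f).
apply: eq_card => a; rewrite inE /label.
apply/idP/imsetP => [/andP[lt2a le_a] | [i _ ->] /=].
  have lt_a : (a - 2 < n - 3)%N by lia.
  by exists (Ordinal lt_a) => //; apply: val_inj => /=; lia.
by have := ltn_ord i; lia.
Qed.

(** Adding particle 1 to [S] gives between 2 and [n - 2] particles, the range covered by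
    genericity. *)
Lemma sigma_neq0 (S : {set 'I_n}) :
  S \subset free_particles -> S != set0 -> sigma dot k S != 0.
Proof.
move=> sSA S_neq0; pose a1 := Ordinal (ltn_trans (isT : 0 < 3)%N hn).
have a1_notin : a1 \notin S by apply/negP => /(subsetP sSA); rewrite inE.
rewrite /sigma (big_pred1 a1) // -big_setU1 //=.
apply: hgeneric; rewrite cardsU1 a1_notin // ltnS card_gt0 S_neq0 /=.
have /leq_ltn_trans -> // := subset_leq_card sSA.
by rewrite card_free_particles; lia.
Qed.

Lemma zvar_free a : a \in free_particles ->
  exists2 i : 'I_(n - 3), (i : nat) = (label a - 3)%N & zvar F a = 'X_i.
Proof.
rewrite inE => /andP[lt2a le_a]; rewrite /zvar lt2a gtn_eqF //.
have lt_a : (label a - 3 < n - 3)%N by move: le_a; rewrite /label; lia.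
by exists (Ordinal lt_a) => //; rewrite (insubT (fun i => i < n - 3)%N lt_a).
Qed.

(** Index [i] stands for degree [i + 1]; the coefficients are constant polynomials, hence units when
    nonzero. *)
Definition leading_form (i : nat) : {mpoly F[n - 3]} :=
  squarefree_form (fun S => (sigma dot k S)%:MP) (@zvar F n) free_particles i.+1.

Lemma leading_forms_koszul : koszul_mod 0 (n - 3) leading_form.
Proof.
suff K : koszul_mod 0 #|free_particles| leading_form.
  by move: K; rewrite [X in koszul_mod _ X]card_free_particles.
apply: (squarefree_forms_koszul (A0 := free_particles)
  (rho := fun a => kill_var F (n - 3) (label a - 3))) => //.
- by move=> S sSA S0; rewrite rmorph_unit // unitfE sigma_neq0.
- by move=> a /zvar_free[i _ ->]; rewrite -msize_poly_eq0 msizeX mdeg1.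
- by move=> a S; apply: comp_mpolyC.
- move=> a b a_free b_free; have [i Ei ->] := zvar_free b_free.
  rewrite kill_varX Ei; congr (if _ then _ else _).
  move: a_free b_free; rewrite !inE -val_eqE /label /=; lia.
- by move=> a p /zvar_free[i <- ->]; apply: kill_varE.
Qed.

Lemma prod_zvar_homog (S : {set 'I_n}) : S \subset free_particles ->
  \prod_(a in S) zvar F a \is #|S|.-homog.
Proof.
move=> sSA; rewrite -sum1_card.
apply: (big_rec2 (fun d (p : {mpoly F[n - 3]}) => p \is d.-homog)).
  exact: dhomog1.
move=> a d p aS hp; apply: dhomogM => //.
by have [i _ ->] := zvar_free (subsetP sSA a aS); rewrite dhomogX /= mdeg1.
Qed.

Lemma leading_form_homog i : leading_form i \is i.+1.-homog.
Proof.
apply: rpred_sum => S /andP[sSA /eqP <-].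
by rewrite mul_mpolyC; apply/rpredZ/prod_zvar_homog.
Qed.

(* A monomial of h_(i+1) involving z_2 = 1 has degree i. *)
Lemma scattering_poly_sub_leading i :
  low i.+1 0 (scattering_poly dot k i.+1 - leading_form i).
Proof.
pose a2 := Ordinal (ltn_trans (isT : 1 < 3)%N hn).
pose A := [set a : 'I_n | (2 <= label a <= n - 1)%N].
have EA : A = a2 |: free_particles.
  apply/setP => a; rewrite !inE -val_eqE /label /=.
  by have := ltn_ord a; lia.
rewrite /scattering_poly -/A (bigID (fun S : {set 'I_n} => a2 \in S)) /=.
(* The sets avoiding particle 2 contribute exactly the leading form. *)
rewrite -addrA [X in _ + X](_ : _ = 0) ?addr0; last first.
  apply/eqP; rewrite subr_eq0; apply/eqP/eq_big => [S|S _]; last first.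
    by rewrite mul_mpolyC.
  rewrite andbAC -subsetD1 EA setU1K //.
  by rewrite inE.
apply: low_sum => S /andP[/andP[sSA /eqP cardS] a2S].
rewrite (bigD1 a2) //= {1}/zvar eqxx mul1r.
rewrite (eq_bigl (mem (S :\ a2))); last by move=> a; rewrite /= in_setD1 andbC.
have sS'A : S :\ a2 \subset free_particles by rewrite subDset -EA.
have cardS' : #|S :\ a2| = i by apply/eqP; rewrite -eqSS -cardS (cardsD1 a2 S) a2S.
move=> m; rewrite addn0 => lt_im.
rewrite mcoeffZ (dhomog_nemf_coeff (prod_zvar_homog sS'A)) ?mulr0 //.
by rewrite cardS' /= gtn_eqF.
Qed.

Lemma scattering_polys_H_basis :
  H_basis (generated_ideal (scattering_polys dot k)) (scattering_polys dot k).
Proof.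
(* Here [S] is the successor on [nat], the degree of the form with index [i]. *)
apply: (H_basis_of_koszul (e := S)
  (h := fun i => scattering_poly dot k i.+1) _ _ leading_forms_koszul).
- by move=> i _; apply: leading_form_homog.
- by move=> i _; apply: scattering_poly_sub_leading.
Qed.

End ScatteringEquations.

Theorem theorem3 (R : realType) (D n : nat) (hn : (4 <= n)%N)
    (dot : {symmetric 'rV[R[i]]_D}) (k : 'I_n -> 'rV[R[i]]_D)
    (hmassless : massless dot k)
    (hconservation : momentum_conservation k)
    (hgeneric : generic_momenta dot k) :
  H_basis (generated_ideal (scattering_polys dot k)) (scattering_polys dot k).
Proof. exact: scattering_polys_H_basis. Qed.
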